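(* Let $n\ge 1$ and $\lambda=(n,n)$. Then for every integer $i\ge 0$, the number of inverted Young tableaux of shape $(n,n)$ with exactly $i$ inversions is $$|S_i(n,n)|=\left(\sum_{k_1+\dots+k_i=n}C_{k_1}C_{k_2}\cdots C_{k_i}\right)+\left(\sum_{l_1+\dots+l_{i+1}=n}C_{l_1}C_{l_2}\cdots C_{l_{i+1}}\right),$$ where $C_j=\frac{1}{j+1}\binom{2j}{j}$ is the $j$-th Catalan number and the two sums run over all ordered compositions of $n$ into exactly $i$ positive parts and exactly $i+1$ positive parts, respectively (an empty sum being $0$).
   Context: A tableau of shape $(n,n)$ is a bijective filling of a $2\times n$ array of boxes with $1,\dots,2n$; it is row-standard if entries increase left to right along each row. For a row-standard tableau $\tau$, a pair of entries $i<j$ in the same column is an inversion if either (1) $i$ or $j$ has no entry immediately to its right and $i$ lies below $j$, or (2) $i$ is immediately followed on its right by $i'$, $j$ is immediately followed on its right by $j'$, and $i'>j'$. $S_i(n,n)$ denotes the set of row-standard tableaux of shape $(n,n)$ with exactly $i$ inversions. *)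

(* Defs.v *)
From mathcomp Require Import all_boot.

Set Implicit Arguments.
Unset Strict Implicit.
Unset Printing Implicit Defensive.

(* A box is a pair (row, column); row 0 is the top row, so a larger row index
   means lower in the array. *)
Definition box (n : nat) : finType := ('I_2 * 'I_n)%type.

Definition filling (n : nat) : finType := {ffun box n -> 'I_(2 * n)}.

(* 'I_(2 * n) is {0, .., 2n - 1}; the entry written in a box is in {1, .., 2n} *)
Definition entry (n : nat) (T : filling n) (b : box n) : nat := (T b).+1.

Definition tableau (n : nat) (T : filling n) : bool :=
  injectiveb T && [forall v, exists b, T b == v].

Definition row_standard (n : nat) (T : filling n) : bool :=
  [forall r : 'I_2, forall c : 'I_n, forall d : 'I_n,
     (c < d) ==> (entry T (r, c) < entry T (r, d))].

Definition right_entry (n : nat) (T : filling n) (b : box n) : option nat :=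
  omap (fun c : 'I_n => entry T (b.1, c)) (insub b.2.+1).

(* p and q are the boxes of the entries i < j; in the last case one of the two
   has no right neighbour and p must lie strictly below q. *)
Definition inversion (n : nat) (T : filling n) (p q : box n) : bool :=
  [&& p.2 == q.2, entry T p < entry T q &
      match right_entry T p, right_entry T q with
      | Some i', Some j' => i' > j'
      | _, _ => p.1 > q.1
      end].

Definition inversions (n : nat) (T : filling n) : {set box n * box n} :=
  [set pq | inversion T pq.1 pq.2].

Definition inverted_tableaux (i n : nat) : {set filling n} :=
  [set T | [&& tableau T, row_standard T & #|inversions T| == i]].

Definition catalan (j : nat) : nat := 'C(2 * j, j) %/ j.+1.

(* The natural-number division in [catalan] is exact. *)
Lemma catalanE (j : nat) : j.+1 * catalan j = 'C(2 * j, j).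
Proof.
rewrite mulnC divnK //.
have E : j.+1 * 'C(2 * j, j.+1) = j * 'C(2 * j, j).
  by rewrite mul_bin_left mul2n -addnn addnK.
have -> : 'C(2 * j, j) = j.+1 * 'C(2 * j, j) - j.+1 * 'C(2 * j, j.+1).
  by rewrite E mulSn addnK.
by rewrite -mulnBr dvdn_mulr.
Qed.

(* Positive parts of a composition of n are at most n, so 'I_n.+1 holds them. *)
Definition is_composition (n m : nat) (k : {ffun 'I_m -> 'I_n.+1}) : bool :=
  [forall t, 0 < k t] && (\sum_(t < m) k t == n).

(* Main.v *)
Require Import Defs.
From mathcomp Require Import all_boot zify.

Set Implicit Arguments.
Unset Strict Implicit.
Unset Printing Implicit Defensive.

(** A row-standard tableau of shape (n, n) is a balanced word recording the row
    of each entry.  Let the sign of a column tell whether its top entry is the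
    smaller one, and append one column of positive sign; then an inversion is
    exactly a sign change between consecutive columns.  Reading the word from
    the largest entry down, it becomes a path of length 2n from 0 to 0 with i
    zero crossings, and a path at height h with m crossings to come is counted
    by the ballot number b(2n, h + 2m), as both obey the same recursion.
    On the other side, with c(x) the generating function of C_1, C_2, ..., the
    sums over compositions are the coefficients of c^m, and c = x (1 + c)^2
    (Segner's recurrence) gives [x^n] (c^i + c^(i+1)) the two-step ballot
    recursion. *)

(** * Recurrences for the Catalan numbers *)

Lemma catalanS (j : nat) : j.+2 * catalan j.+1 = (4 * j + 2) * catalan j.
Proof.
have E1 := catalanE j; have E2 := catalanE j.+1.
(* The two central binomials are linked through 'C(2j + 1, j). *)
have E3 : (2 * j).+2 * 'C((2 * j).+1, j) = j.+1 * 'C((2 * j).+2, j.+1).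
  exact: (mul_bin_diag (2 * j).+2 j).
have E4 : (2 * j).+1 * 'C(2 * j, j) = j.+1 * 'C((2 * j).+1, j).
  have -> : j.+1 = (2 * j).+1 - j by lia.
  exact: (mul_bin_down (2 * j).+1 j).
move: E2; have -> : 2 * j.+1 = (2 * j).+2 by lia.
move=> E2; apply/eqP; rewrite -(eqn_pmul2l (ltn0Sn j)); apply/eqP.
nia.
Qed.

(** Induction on n, evaluating the sum of (i + 1) C_i C_(n+1-i) in two ways. By symmetry it is (n +
    3) / 2 times the convolution [S n.+1]; by [catalanS] and the induction hypothesis it is (2n + 3)
    C_(n+1). A last use of [catalanS] concludes. *)
Lemma catalan_segner (n : nat) :
  catalan n.+1 = \sum_(i < n.+1) catalan i * catalan (n - i).
Proof.
elim: n => [|n IHn]; first by rewrite big_ord1.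
set S := fun m => \sum_(i < m.+1) catalan i * catalan (m - i).
(* symmetry i <-> m - i evaluates the weighted sum *)
have weighted m : 2 * \sum_(i < m.+1) i * (catalan i * catalan (m - i)) = m * S m.
  rewrite mul2n -addnn {1}(reindex_inj rev_ord_inj) /= -big_split /= big_distrr /=.
  apply: eq_bigr => i _; rewrite subSS subKn; last by rewrite -ltnS.
  by rewrite (mulnC (catalan i)) -mulnDl subnK // -ltnS.
have step : \sum_(i < n.+2) i.+1 * (catalan i * catalan (n.+1 - i))
          = catalan n.+1 + (4 * \sum_(i < n.+1) i * (catalan i * catalan (n - i)) + 2 * S n).
  rewrite big_ord_recl /= subn0 mul1n (_ : catalan 0 = 1) // mul1n; congr (_ + _).
  rewrite !big_distrr /= -big_split /=; apply: eq_bigr => i _.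
  rewrite /bump add1n subSS mulnA catalanS; lia.
have split1 : \sum_(i < n.+2) i.+1 * (catalan i * catalan (n.+1 - i))
          = S n.+1 + \sum_(i < n.+2) i * (catalan i * catalan (n.+1 - i)).
  by rewrite -big_split /=; apply: eq_bigr => i _; rewrite mulSn.
have := weighted n.+1; have := weighted n; rewrite -/(S n) -/(S n.+1).
rewrite -/(S n) in IHn; move=> W1 W2.
have := catalanS n.+1.
apply: contra_eq => /eqP; nia.
Qed.

(** * Coefficients of x^n in the powers c(x)^m *)

Fixpoint catalan_conv (m n : nat) : nat :=
  if m is m'.+1 then \sum_(k < n) catalan k.+1 * catalan_conv m' (n - k.+1)
  else n == 0.

Arguments catalan_conv : simpl never.

Lemma catalan_conv_recl (m n : nat) :
  catalan_conv m.+1 n = \sum_(k < n) catalan k.+1 * catalan_conv m (n - k.+1).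
Proof. by []. Qed.

Lemma catalan_convS0 (m : nat) : catalan_conv m.+1 0 = 0.
Proof. by rewrite catalan_conv_recl big_ord0. Qed.

Lemma catalan_conv1 (n : nat) : catalan_conv 1 n.+1 = catalan n.+1.
Proof.
rewrite catalan_conv_recl big_ord_recr /= subnn muln1 big1 // => i _.
by rewrite /catalan_conv subSS subn_eq0 leqNgt ltn_ord muln0.
Qed.

(* Coefficientwise form of c = x (1 + c)^2 multiplied by c^m. *)
Lemma catalan_convSS (m n : nat) :
  catalan_conv m.+1 n.+1
  = catalan_conv m n + 2 * catalan_conv m.+1 n + catalan_conv m.+2 n.
Proof.
elim: m n => [|m IHm] n.
  rewrite catalan_conv1 catalan_segner.
  case: n => [|n]; first by rewrite big_ord1 !catalan_convS0.
  (* The two end terms of Segner's sum, where one factor is C_0 = 1, give the term 2c; the inner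
     terms give c^2. *)
  rewrite catalan_conv1 big_ord_recl big_ord_recr (catalan_conv_recl 1) big_ord_recr.
  rewrite /= subnn catalan_convS0 muln0 addn0 (_ : catalan_conv 0 n.+1 = 0) //.
  rewrite /= add0n subn0 /bump !add1n.
  rewrite (_ : catalan 0 = 1) // mul1n muln1 mul2n -addnn.
  rewrite -!addnA; congr (_ + _); rewrite addnC; congr (_ + _).
  apply: eq_bigr => i _; rewrite subSS.
  have -> : n - i = (n - i.+1).+1 by have := ltn_ord i; lia.
  by rewrite catalan_conv1.
rewrite catalan_conv_recl big_ord_recr /= subnn catalan_convS0 muln0 addn0.
rewrite (catalan_conv_recl m) (catalan_conv_recl m.+1) (catalan_conv_recl m.+2).
rewrite big_distrr -!big_split; apply: eq_bigr => i _ /=.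
rewrite subSS; have -> : n - i = (n - i.+1).+1 by have := ltn_ord i; lia.
by rewrite IHm (mulnCA 2) !(mulnDr (catalan i.+1)).
Qed.

(** * Sums over compositions, by splitting off the first part *)

Section FfunCons.
Variables (N m : nat).

Definition ffun_cons (p : 'I_N * {ffun 'I_m -> 'I_N}) : {ffun 'I_m.+1 -> 'I_N} :=
  [ffun t => if unlift ord0 t is Some s then p.2 s else p.1].

Definition ffun_uncons (f : {ffun 'I_m.+1 -> 'I_N}) :=
  (f ord0, [ffun t => f (lift ord0 t)]).

Lemma ffun_cons0 p : ffun_cons p ord0 = p.1.
Proof. by rewrite ffunE unlift_none. Qed.

Lemma ffun_consS p t : ffun_cons p (lift ord0 t) = p.2 t.
Proof. by rewrite ffunE liftK. Qed.

Lemma ffun_consK : cancel ffun_cons ffun_uncons.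
Proof.
move=> [x g]; rewrite /ffun_uncons ffun_cons0; congr (_, _).
by apply/ffunP => t; rewrite ffunE ffun_consS.
Qed.

Lemma ffun_unconsK : cancel ffun_uncons ffun_cons.
Proof.
move=> f; apply/ffunP => t; rewrite ffunE.
by case: unliftP => [s ->|->] //=; rewrite ffunE.
Qed.

End FfunCons.

(* The bound N on the parts is decoupled from n, so that the induction on the
   number of parts can lower n. *)
Lemma sum_compositions_bound (N m n : nat) : n < N ->
  \sum_(k : {ffun 'I_m -> 'I_N} | [forall t, 0 < k t] && (\sum_(t < m) k t == n))
     \prod_(t < m) catalan (k t) = catalan_conv m n.
Proof.
elim: m n => [|m IHm] n ltnN.
  have f0 (k : {ffun 'I_0 -> 'I_N}) : k = [ffun t => Ordinal ltnN].
    by apply/ffunP => -[].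
  rewrite big_mkcond (big_pred1 [ffun t => Ordinal ltnN]) => [|k]; last first.
    by rewrite /= (f0 k) eqxx.
  rewrite !big_ord0 (_ : [forall t, _]); last by apply/forallP => -[].
  by case: n ltnN {f0}.
rewrite (reindex (@ffun_cons N m)) /=; last first.
  by exists (@ffun_uncons N m) => x _; rewrite (ffun_consK, ffun_unconsK).
(* The bound x <= n must be explicit: for x > n the truncated n - x is 0, and with no parts left [Q]
   would hold. *)
pose P (x : 'I_N) := 0 < x <= n.
pose Q (x : 'I_N) (g : {ffun 'I_m -> 'I_N}) :=
  [forall t, 0 < g t] && (\sum_(t < m) g t == n - x).
rewrite (eq_big (fun p => P p.1 && Q p.1 p.2)
   (fun p => catalan p.1 * \prod_(t < m) catalan (p.2 t))); first last.
- move=> p _; rewrite big_ord_recl ffun_cons0; congr (_ * _).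
  by apply: eq_bigr => t _; rewrite ffun_consS.
- move=> p; rewrite /P /Q big_ord_recl ffun_cons0.
  rewrite (eq_bigr (fun t => p.2 t : nat)) => [|t _]; last by rewrite ffun_consS.
  have -> : [forall t, 0 < ffun_cons p t] = (0 < p.1) && [forall t, 0 < p.2 t].
    apply/forallP/andP => [pos|[pos0 /forallP pos] t].
      by split; [have := pos ord0; rewrite ffun_cons0 |
        apply/forallP => t; have := pos (lift ord0 t); rewrite ffun_consS].
    by rewrite ffunE; case: unlift.
  by case: [forall t, 0 < p.2 t]; rewrite ?andbF //=; lia.
rewrite -(pair_big_dep P Q (fun x g => catalan x * \prod_(t < m) catalan (g t))) /=.
under eq_bigr => x /andP[x_gt0 _].
  rewrite -big_distrr /= IHm; last by apply: leq_ltn_trans ltnN; exact: leq_subr.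
  over.
rewrite catalan_conv_recl.
rewrite -(big_mkord xpredT (fun k => catalan k.+1 * catalan_conv m (n - k.+1))).
rewrite -(big_add1 _ _ 0 n.+1 xpredT (fun k => catalan k * catalan_conv m (n - k))).
rewrite -(big_mkord (fun k => 0 < k <= n) (fun k => catalan k * catalan_conv m (n - k))).
rewrite (big_cat_nat (n := n.+1)) //= addnC big_nat_cond big_pred0 ?add0n.
  by rewrite big_ltn_cond //= big_nat_cond [RHS]big_nat_cond; apply: eq_bigl => k; lia.
by move=> k; lia.
Qed.

Lemma sum_compositions (m n : nat) :
  \sum_(k : {ffun 'I_m -> 'I_n.+1} | is_composition k) \prod_(t < m) catalan (k t)
  = catalan_conv m n.
Proof. exact: sum_compositions_bound. Qed.

(** * Ballot numbers: nonnegative paths of [r] unit steps from height [j] to 0 *)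

Fixpoint ballot (r j : nat) : nat :=
  if r is r'.+1 then ballot r' j.+1 + (if j is j'.+1 then ballot r' j' else 0)
  else j == 0.

(** Two steps from 2m lead to 2m + 2, twice to 2m, and to 2m - 2, as in [catalan_convSS] added for
    two consecutive powers. At m = 0 only one path returns to 0, which agrees with the vanishing of
    c^0 in degree n + 1. *)
Lemma ballot_even (n m : nat) :
  ballot n.*2 m.*2 = catalan_conv m n + catalan_conv m.+1 n.
Proof.
elim: n m => [|n IHn] m.
  by case: m => [|m]; rewrite ?catalan_convS0 //.
case: m => [|m]; rewrite doubleS /= -?doubleS !IHn ?catalan_convSS.
  by rewrite (_ : catalan_conv 0 n.+1 = 0) //; nia.
by nia.
Qed.

(* A word lists the row (true = top) of each entry, from the largest entry to
   the smallest.  Read in this order, the entries not yet matched in their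
   column all lie in one row; [h] counts them, and [s] tells whether the top
   entry is the smaller one in the column completed last (if h = 0) or next
   (if h > 0). *)
Fixpoint word_changes (s : bool) (h : nat) (u : seq bool) : nat :=
  if u is b :: u' then
    if h is h'.+1 then word_changes s (if b == s then h' else h.+1) u'
    else (b == s) + word_changes (~~ b) 1 u'
  else 0.

Fixpoint word_height (s : bool) (h : nat) (u : seq bool) : nat :=
  if u is b :: u' then
    if h is h'.+1 then word_height s (if b == s then h' else h.+1) u'
    else word_height (~~ b) 1 u'
  else h.

Lemma card_tupleS (r : nat) (P : pred (seq bool)) :
  #|[set u : r.+1.-tuple bool | P u]|
  = #|[set u : r.-tuple bool | P (true :: u)]|
    + #|[set u : r.-tuple bool | P (false :: u)]|.
Proof.
pose f b (u : r.-tuple bool) := [tuple of b :: u].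
have f_inj b : injective (f b) by move=> u v /(congr1 val) [] /val_inj.
rewrite -(card_imset _ (f_inj true)) -(card_imset _ (f_inj false)).
rewrite -cardsUI [X in _ = _ + X](_ : _ = 0) ?addn0; last first.
  apply/eqP; rewrite cards_eq0; apply/eqP/setP => u; rewrite !inE.
  by apply/andP => -[/imsetP[v _ ->] /imsetP[w _ /(congr1 val)]].
apply: eq_card => u; rewrite !inE; apply/idP/orP => [Pu|].
  case: (tupleP u) Pu => -[] v Pu; [left|right];
  by apply/imsetP; exists v; rewrite ?inE.
by case=> /imsetP[v]; rewrite inE => Pv ->.
Qed.

(** Take h + 2m as the ballot height. Leaving 0 without crossing raises h, an up step; crossing
    raises h by one but lowers m by one, a down step, impossible when m = 0. *)
Lemma card_word_changes (r : nat) (s : bool) (h m : nat) :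
  #|[set u : r.-tuple bool | (word_height s h u == 0) && (word_changes s h u == m)]|
  = ballot r (h + m.*2).
Proof.
elim: r s h m => [|r IHr] s h m.
  rewrite /= addn_eq0 double_eq0.
  rewrite (eq_card (B := if (h == 0) && (m == 0) then predT else pred0)); last first.
    by move=> u; rewrite inE tuple0 /= (eq_sym 0); case: ifP.
  by case: ifP => _; rewrite ?card_tuple ?card0.
rewrite (card_tupleS r (fun u => (word_height s h u == 0) && (word_changes s h u == m))).
case: h => [|h].
  have E b : #|[set u : r.-tuple bool | (word_height s 0 (b :: u) == 0)
                 && (word_changes s 0 (b :: u) == m)]|
      = if b == s then (if m is m'.+1 then ballot r (1 + m'.*2) else 0)
        else ballot r (1 + m.*2).
    case: ifP => bs; last by rewrite -(IHr (~~ b)) /= bs.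
    case: m => [|m] /=; rewrite bs; last by rewrite -(IHr (~~ b)).
    by apply: eq_card0 => u; rewrite inE /= andbF.
  rewrite !E; case: s {E} => /=; case: m => [|m] //=; rewrite ?add1n ?addn0 //.
  by rewrite addnC.
have E b : #|[set u : r.-tuple bool | (word_height s h.+1 (b :: u) == 0)
                 && (word_changes s h.+1 (b :: u) == m)]|
      = if b == s then ballot r (h + m.*2) else ballot r (h.+2 + m.*2).
  by case: ifP => bs; rewrite -(IHr s) /= bs.
by rewrite !E; case: s {E} => /=; rewrite ?addSn // addnC.
Qed.

(** The [h] pending letters all equal [~~ s], so height 0 at the end means that the letters balance.
    At h = 0 this is symmetric in [s], hence unaffected by a change of sign. *)
Lemma word_height_eq0 (s : bool) (h : nat) (u : seq bool) :
  (word_height s h u == 0) = (h + count_mem (~~ s) u == count_mem s u).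
Proof.
elim: u s h => [|b u IHu] s [|h] //=; rewrite ?addn0 // IHu;
by case: s b {IHu} => -[] /=; lia.
Qed.

(** * Sign changes read off the positions of the letters *)

Fixpoint positions (b : bool) (k : nat) (u : seq bool) : seq nat :=
  if u is x :: u' then
    if x == b then k :: positions b k.+1 u' else positions b k.+1 u'
  else [::].

Lemma size_positions b k u : size (positions b k u) = count_mem b u.
Proof. by elim: u k => //= x u IHu k; case: ifP => _ /=; rewrite IHu. Qed.

Lemma mem_positions b k u j :
  (j \in positions b k u)
  = [&& k <= j, j - k < size u & nth (~~ b) u (j - k) == b].
Proof.
elim: u k => [|x u IHu] k; first by rewrite ltn0 andbF.
have -> : (j \in positions b k (x :: u))
    = (j == k) && (x == b) || (j \in positions b k.+1 u).
  by rewrite /=; case: ifP => _; rewrite ?in_cons ?andbT ?andbF.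
rewrite IHu; case: (ltngtP k j) => [ltkj|gtkj|<-] //=.
  by have -> : j - k = (j - k.+1).+1 by lia.
by rewrite subnn /= orbF.
Qed.

Lemma positions_sorted b k u : sorted ltn (positions b k u).
Proof.
elim: u k => //= x u IHu k; case: ifP => _ //=.
rewrite path_min_sorted //; apply/allP => j.
by rewrite mem_positions => /and3P[].
Qed.

Fixpoint changes (s : bool) (S : seq bool) : nat :=
  if S is x :: S' then (x != s) + changes x S' else 0.

Lemma changesE s S :
  changes s S = \sum_(k < size S) (nth s S k != nth s (s :: S) k).
Proof.
elim: S s => [|x S IHS] s; first by rewrite big_ord0.
rewrite /= IHS big_ord_recl; congr (_ + _); apply: eq_bigr => k _.
rewrite lift0 /= (set_nth_default s) //; congr (nat_of_bool (_ != _)).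
by case: (k : nat) (ltn_ord k) => //= k' ?; rewrite (set_nth_default s) // ltnW.
Qed.

(** With [P] for the top row, a later top position means a smaller top entry, since words start from
    the largest entry. *)
Definition signs (P Q : seq nat) : seq bool := [seq x.2 < x.1 | x <- zip P Q].

(** The list [q] is the queue of positions of the pending letters, all in the row [~~ s], and [k] is
    the position of the next letter. Zipping the rows matches first in, first out; as [q] lies below
    [k], each column completed from it has sign [s]. *)
Lemma changes_positions s h u k q :
    word_height s h u = 0 -> size q = h -> all (fun x => x < k) q ->
  changes s (signs ((if s then [::] else q) ++ positions true k u)
                   ((if s then q else [::]) ++ positions false k u))
  = word_changes s h u.
Proof.
elim: u s h k q => [|b u IHu] s h k q.
  by move=> /= -> /size0nil ->; case: s.
case: h => [|h] hu; last first.
  case: q => // x q [szq] /= /andP[ltxk ltqk].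
  have ltqk1 : all (fun x => x < k.+1) q.
    by apply: sub_all ltqk => y /ltnW.
  move: hu => /=; case: eqP => [->|/eqP neq] hu.
    rewrite -(IHu s h k.+1 q) //.
    by case: s hu => hu /=; rewrite ?ltxk //= ltnNge (ltnW ltxk).
  rewrite -(IHu s h.+2 k.+1 (x :: rcons q k)) //=; last 2 first.
  - by rewrite size_rcons szq.
  - by rewrite all_rcons ltqk1 ltnSn ltnW.
  by case: s b neq hu => -[] //= _ _; rewrite cat_rcons.
move=> /size0nil -> _ /=.
rewrite -(IHu (~~ b) 1 k.+1 [:: k]) /= ?ltnSn //.
have /eqP := hu; rewrite /= word_height_eq0 negbK => /eqP cu.
(* [word_changes] charges a change when a column is opened. The partner [y] of [k], which exists by
   balance, comes later, so the sign of this column is indeed [~~ b]. *)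
have pos_cons : exists y p, positions (~~ b) k.+1 u = y :: p /\ k < y.
  have := size_positions (~~ b) k.+1 u; rewrite -cu.
  case E : positions => [|y p] // _; exists y, p; split=> //.
  have : y \in positions (~~ b) k.+1 u by rewrite E inE eqxx.
  by rewrite mem_positions => /and3P[].
case: pos_cons => y [p [E ltky]] {IHu hu cu}.
by case: b s E => -[] /= -> /=; rewrite ?ltky ?ltnNge ?(ltnW ltky).
Qed.

Lemma changes_word u : count_mem true u = count_mem false u ->
  changes true (signs (positions true 0 u) (positions false 0 u))
  = word_changes true 0 u.
Proof.
move=> cu; apply: (changes_positions (s := true) (q := [::])) => //.
by apply/eqP; rewrite word_height_eq0 cu.
Qed.

(** * Inversions as sign changes between consecutive columns *)

Section Columns.
Variable n : nat.
Implicit Type T : filling n.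

(* The value true beyond the last column accounts for the rule for entries
   without right neighbour. *)
Definition column_sign T (c : nat) : bool :=
  if insub c is Some c' then T (ord0, c') < T (ord_max, c') else true.

Lemma column_sign_ord T (c : 'I_n) : column_sign T c = (T (ord0, c) < T (ord_max, c)).
Proof. by rewrite /column_sign valK. Qed.

Lemma ord2P (r : 'I_2) : r = ord0 \/ r = ord_max.
Proof. by case: r => -[|[|//]] lt; [left|right]; apply: val_inj. Qed.

Lemma tableau_inj T : tableau T -> injective T.
Proof. by case/andP => /injectiveP. Qed.

Lemma card_inversions T : tableau T ->
  #|inversions T| = \sum_(c < n) (column_sign T c != column_sign T c.+1).
Proof.
move=> /tableau_inj T_inj.
(* Only the pair with the smaller entry first can be an inversion, so inversions are indexed by
   columns. *)
pose col_pair (c : 'I_n) : box n * box n :=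
  if column_sign T c then ((ord0, c), (ord_max, c)) else ((ord_max, c), (ord0, c)).
have col_pair_inj : injective col_pair.
  by move=> c d; rewrite /col_pair; do 2!case: ifP => _; case.
have neqT c : T (ord0, c) <> T (ord_max, c) :> nat.
  by move/val_inj/T_inj.
have ltT c : (T (ord_max, c) < T (ord0, c)) = ~~ column_sign T c.
  by rewrite column_sign_ord -leqNgt [RHS]leq_eqVlt eq_sym; case: eqP => // /neqT.
have -> : inversions T = col_pair @: [set c : 'I_n | column_sign T c != column_sign T c.+1].
  apply/setP => -[[r c] [r' c']]; rewrite inE /inversion /= /entry !ltnS.
  (* Both clauses say that row [r] is not the one of the smaller entry in the next column, a missing
     column counting as positive. *)
  have colE : match right_entry T (r, c), right_entry T (r', c) with
      | Some i', Some j' => j' < i' | _, _ => r' < r end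
    = (r != r') && ((r == ord0) != column_sign T c.+1).
    rewrite /right_entry /column_sign /=; case: insubP => [d _ _|_] /=.
      rewrite /entry ltnS.
      by case: (ord2P r) (ord2P r') => -> [] ->; rewrite ?ltnn ?eqxx //= ?ltT
        ?column_sign_ord //; case: (_ < _).
    by case: (ord2P r) (ord2P r') => -> [] ->.
  apply/and3P/imsetP => [[/eqP /= <-]|[d]].
    rewrite colE => lt /andP[neq sgn]; exists c; rewrite ?inE /col_pair; move: lt neq sgn;
    by case: (ord2P r) (ord2P r') => -> [] ->; rewrite ?ltnn ?eqxx //= ?ltT
       -?column_sign_ord; case: (column_sign T c).
  rewrite inE /col_pair => sgn.
  case: ifP => sc E; case: E colE => -> -> -> -> colE; rewrite sc in sgn.
    by rewrite eqxx -column_sign_ord sc colE; split.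
  by rewrite eqxx ltT sc colE; split.
rewrite card_imset // -sum1_card big_mkcond; apply: eq_bigr => c _.
by rewrite inE; case: (_ != _).
Qed.

End Columns.

(** * Bijection between balanced words and row-standard tableaux *)

Section WordFilling.
Variable n : nat.
Implicit Type u : (2 * n).-tuple bool.

(** The box [b] witnesses n > 0. *)
Lemma word_filling_subproof (p : nat) (b : box n) : (2 * n).-1 - p < 2 * n.
Proof. by case: b => _ [c ltcn]; lia. Qed.

Definition row_positions u (r : 'I_2) : seq nat := positions (r == ord0) 0 u.

(* Words are read from the largest entry down, so values and columns are
   reversed. *)
Definition word_filling u : filling n :=
  [ffun b : box n =>
     Ordinal (word_filling_subproof (nth 0 (row_positions u b.1) (n.-1 - b.2)) b)].

Lemma word_fillingE u r c :
  word_filling u (r, c) = (2 * n).-1 - nth 0 (row_positions u r) (n.-1 - c) :> nat.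
Proof. by rewrite ffunE. Qed.

Lemma count_mem_tuple u : count_mem true u + count_mem false u = 2 * n.
Proof.
rewrite -[RHS](size_tuple u) -[RHS](count_predC (pred1 true)); congr (_ + _).
by apply: eq_count => -[].
Qed.

Lemma word_balanced u : (word_height true 0 u == 0) = (count_mem true u == n).
Proof.
have := count_mem_tuple u; rewrite word_height_eq0 add0n -[~~ true]/false.
by move: (count_mem true u) (count_mem false u) => a b; lia.
Qed.

Lemma size_row_positions u r : count_mem true u = n -> size (row_positions u r) = n.
Proof.
move=> cu; have := count_mem_tuple u; rewrite cu size_positions.
by case: (r == ord0); lia.
Qed.

Lemma mem_row_positions u r j :
  (j \in row_positions u r) = (j < 2 * n) && (nth true u j == (r == ord0)).
Proof.
rewrite mem_positions subn0 size_tuple leq0n /=.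
by case: ltnP => //= ltj; rewrite (set_nth_default true) // size_tuple.
Qed.

Lemma row_positions_sorted u r : sorted ltn (row_positions u r).
Proof. exact: positions_sorted. Qed.

Section Balanced.
Variables (u : (2 * n).-tuple bool) (cu : count_mem true u = n).

Lemma nth_row_positions_mem r (c : 'I_n) :
  nth 0 (row_positions u r) (n.-1 - c) \in row_positions u r.
Proof. by rewrite mem_nth // size_row_positions //; have := ltn_ord c; lia. Qed.

Lemma nth_row_positions_lt r (c : 'I_n) :
  nth 0 (row_positions u r) (n.-1 - c) < 2 * n.
Proof. by have := nth_row_positions_mem r c; rewrite mem_row_positions => /andP[]. Qed.

Lemma word_filling_lt r c r' c' :
  (word_filling u (r, c) < word_filling u (r', c'))
  = (nth 0 (row_positions u r') (n.-1 - c') < nth 0 (row_positions u r) (n.-1 - c)).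
Proof.
rewrite !word_fillingE.
have := nth_row_positions_lt r c; have := nth_row_positions_lt r' c'; lia.
Qed.

(** The value gives the position in the word, the letter there gives the row, and strict increase
    along the row gives the column. *)
Lemma word_filling_inj : injective (word_filling u).
Proof.
move=> [r c] [r' c'] /(congr1 val) /=; rewrite !word_fillingE => eq_val.
have eq_nth : nth 0 (row_positions u r) (n.-1 - c)
    = nth 0 (row_positions u r') (n.-1 - c').
  have := nth_row_positions_lt r c; have := nth_row_positions_lt r' c'; lia.
have eq_r : r = r'.
  have := nth_row_positions_mem r c; have := nth_row_positions_mem r' c'.
  rewrite eq_nth !mem_row_positions => /andP[_ /eqP ->] /andP[_].
  by case: (ord2P r) (ord2P r') => -> [] ->.
rewrite eq_r in eq_nth *; congr (_, _); apply: val_inj => /=.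
have /eqP := eq_nth; rewrite nth_uniq ?size_row_positions //; first last.
- exact/(sorted_uniq ltn_trans ltnn)/row_positions_sorted.
- by have := ltn_ord c'; lia.
- by have := ltn_ord c; lia.
by have := ltn_ord c; have := ltn_ord c'; lia.
Qed.

Lemma word_filling_tableau : tableau (word_filling u).
Proof.
apply/andP; split; first exact/injectiveP/word_filling_inj.
have [|g _ gK] := inj_card_bij word_filling_inj.
  by rewrite card_prod !card_ord.
by apply/forallP => v; apply/existsP; exists (g v); rewrite gK.
Qed.

Lemma word_filling_row_standard : row_standard (word_filling u).
Proof.
apply/forallP => r; apply/forallP => c; apply/forallP => d; apply/implyP => ltcd.
rewrite /entry ltnS word_filling_lt.
apply: (sorted_ltn_nth ltn_trans); rewrite ?row_positions_sorted ?inE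
  ?size_row_positions //; have := ltn_ord c; have := ltn_ord d; lia.
Qed.

Lemma card_inversions_word_filling :
  #|inversions (word_filling u)| = word_changes true 0 u.
Proof.
have cu2 : count_mem true u = count_mem false u.
  by have := count_mem_tuple u; rewrite cu; lia.
rewrite card_inversions ?word_filling_tableau // -changes_word // changesE.
have sz r : size (row_positions u r) = n by exact: size_row_positions.
have sz_zip : size (zip (row_positions u ord0) (row_positions u ord_max)) = n.
  by rewrite size_zip !sz minnn.
rewrite -/(row_positions u ord0) -/(row_positions u ord_max).
set S := signs _ _; have szS : size S = n by rewrite size_map.
have signE k : k < n -> nth true S k = column_sign (word_filling u) (n.-1 - k).
  move=> ltkn; have ltcn : n.-1 - k < n by lia.
  rewrite -[n.-1 - k]/(val (Ordinal ltcn)) column_sign_ord word_filling_lt /=.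
  rewrite (nth_map (0, 0)) ?sz_zip // nth_zip ?sz //=.
  by have -> : n.-1 - (n.-1 - k) = k by lia.
rewrite szS (reindex_inj rev_ord_inj); apply: eq_bigr => k _ /=.
rewrite signE //; congr (nat_of_bool (_ != _)); first by congr column_sign; lia.
(* For k = 0 the right neighbour is the fictitious column n, whose sign [true] is the initial sign
   of [changes]. *)
case: k => -[|k] ltkn /=.
  by rewrite /column_sign insubF //; lia.
by rewrite signE 1?ltnW //; congr column_sign; lia.
Qed.

End Balanced.

Lemma word_filling_in_inj :
  {in [pred u : (2 * n).-tuple bool | count_mem true u == n] &, injective word_filling}.
Proof.
move=> u v /eqP cu /eqP cv eqF.
have eq_pos r : row_positions u r = row_positions v r.
  apply: (@eq_from_nth _ 0); rewrite !size_row_positions // => k ltkn.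
  have ltcn : n.-1 - k < n by lia.
  have := congr1 (fun T : filling n => val (T (r, Ordinal ltcn))) eqF.
  rewrite /= !word_fillingE /=.
  have := nth_row_positions_lt cu r (Ordinal ltcn).
  have := nth_row_positions_lt cv r (Ordinal ltcn).
  by rewrite /= (_ : n.-1 - (n.-1 - k) = k); lia.
apply: val_inj; apply: (@eq_from_nth _ true); rewrite !size_tuple // => j ltj.
by have := mem_row_positions u ord0 j; rewrite eq_pos mem_row_positions ltj /= !eqb_id.
Qed.

Lemma word_filling_surj (T : filling n) : tableau T -> row_standard T ->
  exists2 u : (2 * n).-tuple bool, count_mem true u = n & word_filling u = T.
Proof.
move=> tabT stdT; have T_inj := tableau_inj tabT.
have T_onto v : exists b, T b = v.
  by case/andP: tabT => _ /forallP /(_ v) /existsP[b /eqP]; exists b.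
pose u : (2 * n).-tuple bool :=
  [tuple [exists c, T (ord0, c) == rev_ord j] | j < 2 * n].
have uE (j : 'I_(2 * n)) : nth true u j = [exists c, T (ord0, c) == rev_ord j].
  by rewrite -tnth_nth tnth_mktuple.
have uT b : nth true u (rev_ord (T b)) = (b.1 == ord0).
  rewrite uE rev_ordK; case: b => r c /=; apply/existsP/eqP => [[d /eqP /T_inj[]]|->] //.
  by exists c.
(* Both lists are strictly increasing, the second because rows of [T] increase, so it suffices to
   compare their members. *)
have posE r : row_positions u r
    = [seq nat_of_ord (rev_ord (T (r, rev_ord c))) | c <- enum 'I_n].
  apply: (irr_sorted_eq ltn_trans ltnn); first exact: row_positions_sorted.
    rewrite sorted_map; apply: (@sub_sorted _ (relpre val ltn)); last first.
      by have := iota_ltn_sorted 0 n; rewrite -val_enum_ord sorted_map.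
    move=> c d /= ltcd; have ltdc : rev_ord d < rev_ord c.
      by have := ltn_ord d; rewrite /=; lia.
    move/forallP: stdT => /(_ r) /forallP /(_ (rev_ord d)) /forallP /(_ (rev_ord c)).
    rewrite ltdc /entry ltnS /= => ltT.
    by apply: ltn_sub2l => //; apply: leq_ltn_trans ltT _.
  move=> j; rewrite mem_row_positions; apply/andP/mapP => [[ltj]|[c _ ->]].
    have [[r' c] Tb] := T_onto (rev_ord (Ordinal ltj)).
    have jE : j = rev_ord (T (r', c)) by rewrite Tb rev_ordK.
    rewrite jE uT /= => rr'; exists (rev_ord c); rewrite ?mem_enum ?rev_ordK //.
    by case: (ord2P r) (ord2P r') rr' => -> [] ->.
  by rewrite ltn_ord uT.
have cu : count_mem true u = n.
  by rewrite -(size_positions true 0) -/(row_positions u ord0) posE size_map size_enum_ord.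
exists u => //; apply/ffunP => -[r c]; apply: val_inj; rewrite /= word_fillingE posE.
have ltcn : n.-1 - c < n by have := ltn_ord c; lia.
rewrite (nth_map c) ?size_enum_ord //=.
have -> : nth c (enum 'I_n) (n.-1 - c) = rev_ord c.
  by apply: val_inj; rewrite /= nth_enum_ord //; lia.
by rewrite rev_ordK; case: (T (r, c)) => t /= ltt; lia.
Qed.

Lemma inverted_tableaux_words i :
  inverted_tableaux i n = word_filling @:
    [set u : (2 * n).-tuple bool | (word_height true 0 u == 0) && (word_changes true 0 u == i)].
Proof.
apply/setP => T; rewrite inE; apply/and3P/imsetP.
  move=> [tabT stdT /eqP invT]; have [u cu uT] := word_filling_surj tabT stdT.
  exists u => //; rewrite inE word_balanced cu eqxx /=.
  by rewrite -card_inversions_word_filling // uT invT.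
move=> [u]; rewrite inE word_balanced => /andP[/eqP cu chg] ->.
by rewrite word_filling_tableau // word_filling_row_standard //
  card_inversions_word_filling.
Qed.

Lemma card_inverted_tableaux i : #|inverted_tableaux i n| = ballot (2 * n) i.*2.
Proof.
rewrite inverted_tableaux_words card_in_imset ?card_word_changes //.
move=> u v; rewrite !inE !word_balanced => /andP[cu _] /andP[cv _].
exact: word_filling_in_inj.
Qed.

End WordFilling.

Theorem theorem2p3 (n i : nat) (hn : 1 <= n) :
  #|inverted_tableaux i n| =
    (\sum_(k : {ffun 'I_i -> 'I_n.+1} | is_composition k)
       \prod_(t < i) catalan (k t)) +
    (\sum_(l : {ffun 'I_i.+1 -> 'I_n.+1} | is_composition l)
       \prod_(t < i.+1) catalan (l t)).
Proof. by rewrite card_inverted_tableaux mul2n ballot_even !sum_compositions. Qed.
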